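(* Let $(X,+)$ be an abelian normal subgroup of a Moufang loop $(Q,\cdot)$ and let $a\in Q$. Let $f$ be the restriction of $T_a$ to $X$. Then $f$ is a Moufang permutation on $(X,+)$, with associated biadditive mapping $\beta(x,y)=f^{-1}(f(x)+f(y))-x-y$, and for all integers $i,j$ and all $x,y\in X$: $$a^{3i}x\cdot ya^{3j}=a^{3(i+j)}\Big(f^{-3j}(x)+f^{-3j}(y)+\sum_{k\in I(-2j,i)}f^{-3k}(\beta(x,y))\Big),$$ $$a^{3i}x\cdot a^{3j}y=a^{3(i+j)}\Big(f^{-3j}(x)+y+\sum_{k\in I(i+j,-j)}f^{-3k}(\beta(x,y))\Big).$$
   Context: A loop is Moufang if it satisfies $xy\cdot zx=(x\cdot yz)x$ for all $x,y,z$; Moufang loops are diassociative, so powers are well defined. $T_a(x)=axa^{-1}$ (i.e. $T_a=R_a^{-1}L_a$). Products of elements of $X$ in $Q$ are written $x+y$; juxtaposition binds tighter than $\cdot$. A permutation $f$ of an abelian group $(X,+)$ is a Moufang permutation if the map $\beta(x,y)=f^{-1}(f(x)+f(y))-x-y$ is symmetric, alternating and biadditive, and for all $x,y,z$: $\beta(\beta(x,y),z)=0$ and $\beta(f(x),f(y))=f(\beta(f^3(x),y))$. $I(i,j)$ is $\emptyset$ if $i=j$, $\{i,\dots,j-1\}$ if $i<j$, $\{j,\dots,i-1\}$ if $j<i$. *)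

(* Defs.v *)
From Stdlib Require Import ZArith List.
Import ListNotations.
Open Scope Z_scope.

Section Loops.
Variable Q : Type.
Variables (mul ldiv rdiv : Q -> Q -> Q) (e : Q).

Definition is_loop : Prop :=
  (forall x y, mul x (ldiv x y) = y) /\
  (forall x y, ldiv x (mul x y) = y) /\
  (forall x y, mul (rdiv y x) x = y) /\
  (forall x y, rdiv (mul y x) x = y) /\
  (forall x, mul e x = x) /\ (forall x, mul x e = x).

Definition moufang_law : Prop :=
  forall x y z, mul (mul x y) (mul z x) = mul (mul x (mul y z)) x.

Definition is_moufang_loop : Prop := is_loop /\ moufang_law.

Definition linv (x : Q) : Q := ldiv x e.

(* integer powers (well defined by diassociativity) *)
Definition zpow (x : Q) (n : Z) : Q :=
  if (0 <=? n) then Nat.iter (Z.to_nat n) (mul x) e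
  else Nat.iter (Z.to_nat (- n)) (mul (linv x)) e.

Definition Tmap (a x : Q) : Q := rdiv (mul a x) a.
Definition Tinv (a y : Q) : Q := ldiv a (mul y a).

(* generators of the inner mapping group *)
Definition Linner (x y z : Q) : Q := ldiv (mul x y) (mul x (mul y z)).
Definition Rinner (x y z : Q) : Q := rdiv (mul (mul z x) y) (mul x y).

Definition maps_onto (phi : Q -> Q) (S : Q -> Prop) : Prop :=
  (forall z, S z -> S (phi z)) /\ (forall z, S z -> exists w, S w /\ phi w = z).

Definition is_subloop (S : Q -> Prop) : Prop :=
  S e /\ (forall x y, S x -> S y -> S (mul x y)) /\
  (forall x y, S x -> S y -> S (ldiv x y)) /\
  (forall x y, S x -> S y -> S (rdiv x y)).

Definition abelian_on (S : Q -> Prop) : Prop :=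
  (forall x y z, S x -> S y -> S z -> mul (mul x y) z = mul x (mul y z)) /\
  (forall x y, S x -> S y -> mul x y = mul y x).

(* normal: invariant under (every generator of) the inner mapping group *)
Definition is_normal (S : Q -> Prop) : Prop :=
  forall x y, maps_onto (Tmap x) S /\ maps_onto (Linner x y) S /\
              maps_onto (Rinner x y) S.

Definition abelian_normal_subgroup (S : Q -> Prop) : Prop :=
  is_subloop S /\ abelian_on S /\ is_normal S.
End Loops.

Section MoufangPerm.
Variable T : Type.
Variables (add : T -> T -> T) (opp : T -> T) (zero : T) (f finv : T -> T).

Definition fpow (n : Z) (x : T) : T :=
  if (0 <=? n) then Nat.iter (Z.to_nat n) f x else Nat.iter (Z.to_nat (- n)) finv x.

Definition beta (x y : T) : T :=
  add (add (finv (add (f x) (f y))) (opp x)) (opp y).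

Definition moufang_perm_on (S : T -> Prop) : Prop :=
  (forall x, S x -> S (f x)) /\ (forall x, S x -> S (finv x)) /\
  (forall x, S x -> f (finv x) = x) /\ (forall x, S x -> finv (f x) = x) /\
  (forall x y, S x -> S y -> beta x y = beta y x) /\
  (forall x, S x -> beta x x = zero) /\
  (forall x y z, S x -> S y -> S z -> beta (add x y) z = add (beta x z) (beta y z)) /\
  (forall x y z, S x -> S y -> S z -> beta x (add y z) = add (beta x y) (beta x z)) /\
  (forall x y z, S x -> S y -> S z -> beta (beta x y) z = zero) /\
  (forall x y, S x -> S y -> beta (f x) (f y) = f (beta (fpow 3 x) y)).

Definition zsum (F : Z -> T) (l : list Z) : T :=
  fold_right (fun k acc => add (F k) acc) zero l.
End MoufangPerm.

Definition Iset (i j : Z) : list Z :=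
  if i <? j then map (fun n => i + Z.of_nat n) (seq 0 (Z.to_nat (j - i)))
  else if j <? i then map (fun n => j + Z.of_nat n) (seq 0 (Z.to_nat (i - j)))
  else [].

Arguments is_loop {Q}. Arguments moufang_law {Q}. Arguments is_moufang_loop {Q}.
Arguments linv {Q}. Arguments zpow {Q}. Arguments Tmap {Q}. Arguments Tinv {Q}.
Arguments Linner {Q}. Arguments Rinner {Q}. Arguments maps_onto {Q}.
Arguments is_subloop {Q}. Arguments abelian_on {Q}. Arguments is_normal {Q}.
Arguments abelian_normal_subgroup {Q}.
Arguments fpow {T}. Arguments beta {T}. Arguments moufang_perm_on {T}.
Arguments zsum {T}.

(* Main.v *)
(* Write [L], [R] for the left and right multiplications by [a]; they commute and
   [T_a = L R^-1]. The autotopisms [(L, R, LR)] and [(LR, L^-1, L)] of a Moufang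
   loop express a product [a^(3i) x * y a^(3j)] as
   [a^(3(i+j)) f^(-i-2j) (f^(i-j) x * f^(i-j) y)]. Reading the left Moufang law
   on the coset of [a^3] through this formula gives a functional equation for
   [f], which says that [(X, +)] acts on [X] by
   [z |-> f (f^-1 u + f^-1 z) - u]. The same holds for [f^-1], since
   [T_(a^-1) = T_a^-1], and comparing the two actions shows that [beta] vanishes
   on its own image, whence it is biadditive. The sums come from
   [f^-n (f^n x + f^n y) = x + y + sum_(k in I(0, n)) f^(-3k) (beta x y)],
   where signs do not matter because [beta] has exponent 2. *)

Require Import Defs.
From Stdlib Require Import ZArith List Lia ProofIrrelevance.
Open Scope Z_scope.

(** * Two-sided induction and integer iterates of bijections *)

Lemma Z_bi_ind (P : Z -> Prop) :
  P 0 -> (forall n, P n <-> P (n + 1)) -> forall n, P n.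
Proof.
intros H0 HS n. apply Z.bi_induction; [intros u v ->; reflexivity | exact H0 |].
intros m. rewrite <- Z.add_1_r. apply HS.
Qed.

Section IntegerIterates.
Variables (T : Type) (f finv : T -> T).
Hypothesis fK : forall x, finv (f x) = x.
Hypothesis finvK : forall x, f (finv x) = x.

Lemma fpow_succ n x : fpow f finv (n + 1) x = f (fpow f finv n x).
Proof.
unfold fpow. destruct (Z.leb_spec 0 n) as [Hn|Hn].
- destruct (Z.leb_spec 0 (n + 1)); [|lia].
  replace (Z.to_nat (n + 1)) with (S (Z.to_nat n)) by lia. reflexivity.
- replace (Z.to_nat (- n)) with (S (Z.to_nat (- (n + 1)))) by lia.
  simpl. rewrite finvK. destruct (Z.leb_spec 0 (n + 1)) as [H|H]; [|reflexivity].
  replace (Z.to_nat (n + 1)) with O by lia.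
  replace (Z.to_nat (- (n + 1))) with O by lia. reflexivity.
Qed.

Lemma fpow_add m n x :
  fpow f finv (m + n) x = fpow f finv m (fpow f finv n x).
Proof.
pattern m. revert m. apply Z_bi_ind; [reflexivity|].
intros m. replace (m + 1 + n) with (m + n + 1) by lia.
rewrite !fpow_succ. split; intros H; [now rewrite H|].
rewrite <- (fK (fpow f finv (m + n) x)), H. apply fK.
Qed.

End IntegerIterates.

(** For [op] a loop product this raises an autotopism [(f, g, h)] to an integer power. The backward
    half of the induction cancels [h]. *)
Lemma fpow_map2 (T U V : Type) (op : T -> U -> V) f finv g ginv h hinv
  (fK : forall x, f (finv x) = x) (gK : forall x, g (ginv x) = x)
  (hK : forall x, hinv (h x) = x) (hK' : forall x, h (hinv x) = x)
  (H : forall x y, op (f x) (g y) = h (op x y)) n x y :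
  op (fpow f finv n x) (fpow g ginv n y) = fpow h hinv n (op x y).
Proof.
pattern n. revert n. apply Z_bi_ind; [reflexivity|].
intros n. rewrite !fpow_succ, H by assumption. split; intros E; [now rewrite E|].
now rewrite <- (hK (op _ _)), E, hK.
Qed.

Lemma fpow_map (T V : Type) (op : T -> V) f finv h hinv
  (fK : forall x, f (finv x) = x)
  (hK : forall x, hinv (h x) = x) (hK' : forall x, h (hinv x) = x)
  (H : forall x, op (f x) = h (op x)) n x :
  op (fpow f finv n x) = fpow h hinv n (op x).
Proof.
exact (fpow_map2 T unit V (fun x _ => op x) f finv (fun u => u) (fun u => u)
  h hinv fK (fun _ => eq_refl) hK hK' (fun x _ => H x) n x tt).
Qed.

Lemma fpow_comp (T : Type) (f finv g ginv : T -> T)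
  (fK : forall x, finv (f x) = x) (fK' : forall x, f (finv x) = x)
  (gK : forall x, ginv (g x) = x) (gK' : forall x, g (ginv x) = x)
  (fg : forall x, f (g x) = g (f x)) n x :
  fpow (fun x => f (g x)) (fun x => ginv (finv x)) n x =
  fpow f finv n (fpow g ginv n x).
Proof.
symmetry. pattern n. revert n. apply Z_bi_ind; [reflexivity|].
intros n.
rewrite (fpow_succ _ f finv fK'), (fpow_succ _ g ginv gK'),
  (fpow_succ _ (fun x => f (g x)) (fun x => ginv (finv x)))
  by (intros; now rewrite ?gK', ?fK').
rewrite <- (fpow_map T T g f finv f finv) by auto.
split; intros E; [now rewrite E|].
now rewrite <- (gK (fpow f finv n _)), <- (fK (g _)), E, fK, gK.
Qed.

(** * Moufang loops *)

Section Moufang.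
Variables (Q : Type) (mul ldiv rdiv : Q -> Q -> Q) (e : Q).
Hypothesis HQ : is_moufang_loop mul ldiv rdiv e.
Local Notation "x ** y" := (mul x y) (at level 40, left associativity).
Local Notation inv := (linv ldiv e).

Lemma mulVL x y : x ** ldiv x y = y. Proof. apply HQ. Qed.
Lemma ldivK x y : ldiv x (x ** y) = y. Proof. apply HQ. Qed.
Lemma mulVR x y : rdiv y x ** x = y. Proof. apply HQ. Qed.
Lemma rdivK x y : rdiv (y ** x) x = y. Proof. apply HQ. Qed.
Lemma mul1 x : e ** x = x. Proof. apply HQ. Qed.
Lemma mulr1 x : x ** e = x. Proof. apply HQ. Qed.
Lemma moufang x y z : (x ** y) ** (z ** x) = (x ** (y ** z)) ** x.
Proof. apply HQ. Qed.

Lemma mulL_inj x y z : x ** y = x ** z -> y = z.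
Proof. intros H. now rewrite <- (ldivK x y), H, ldivK. Qed.

Lemma mulR_inj x y z : y ** x = z ** x -> y = z.
Proof. intros H. now rewrite <- (rdivK x y), H, rdivK. Qed.

Lemma flexible x z : x ** (z ** x) = (x ** z) ** x.
Proof. generalize (moufang x e z). now rewrite mulr1, mul1. Qed.

Lemma mul_inv x : x ** inv x = e.
Proof. apply mulVL. Qed.

(** The Moufang law with [y = inv x], after cancelling the trailing [x]. *)
Lemma mulKV x z : x ** (inv x ** z) = z.
Proof.
apply (mulR_inj x). rewrite <- moufang, mul_inv. apply mul1.
Qed.

Lemma inv_mul x : inv x ** x = e.
Proof. apply (mulL_inj x). now rewrite mulKV, mulr1. Qed.

Lemma invK x : inv (inv x) = x.
Proof. apply (mulL_inj (inv x)). now rewrite mul_inv, inv_mul. Qed.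

Lemma mulVK x z : inv x ** (x ** z) = z.
Proof. generalize (mulKV (inv x) z). now rewrite invK. Qed.

Lemma mulrKV x y : (y ** inv x) ** x = y.
Proof.
apply (mulL_inj x). rewrite flexible, <- moufang, inv_mul. apply mulr1.
Qed.

Lemma mulrVK x y : (y ** x) ** inv x = y.
Proof. generalize (mulrKV (inv x) y). now rewrite invK. Qed.

Lemma inv_mulE x y : inv (x ** y) = inv y ** inv x.
Proof.
apply (mulR_inj x). rewrite mulrKV. apply (mulL_inj (x ** y)).
now rewrite mulKV, mulrVK.
Qed.

(** The Moufang law at [x], [yz], [z^-1] reads [(xy)x = (x(yz))(z^-1 x)]. Multiplying on the right
    by [x^-1 z], the inverse of [z^-1 x], cancels the last factor. *)
Lemma left_autotopism x y z : (x ** (y ** x)) ** (inv x ** z) = x ** (y ** z).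
Proof.
rewrite flexible. generalize (moufang x (y ** z) (inv z)).
rewrite mulrVK. intros <-.
replace (inv x ** z) with (inv (inv z ** x)) by now rewrite inv_mulE, invK.
apply mulrVK.
Qed.

Lemma left_moufang x y z : x ** (y ** (x ** z)) = (x ** (y ** x)) ** z.
Proof. now rewrite <- left_autotopism, mulVK. Qed.

(** * Powers of [a] and of the multiplications by [a] *)

Section Powers.
Variable a : Q.
Let f := Tmap mul rdiv a.
Let finv := Tinv mul ldiv a.
Local Notation l := (fpow (mul a) (mul (inv a))).
Local Notation r := (fpow (fun x => x ** a) (fun x => x ** inv a)).
Local Notation fp := (fpow f finv).

Lemma Tmap_K x : finv (f x) = x.
Proof. unfold f, finv, Tmap, Tinv. now rewrite mulVR, ldivK. Qed.

Lemma Tinv_K x : f (finv x) = x.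
Proof. unfold f, finv, Tmap, Tinv. now rewrite mulVL, rdivK. Qed.

Lemma TmapE x : f x = (a ** x) ** inv a.
Proof. apply (mulR_inj a). unfold f, Tmap. now rewrite mulVR, mulrKV. Qed.

Lemma l_add m n x : l m (l n x) = l (m + n) x.
Proof. symmetry; apply fpow_add; [apply mulVK | apply mulKV]. Qed.

Lemma r_add m n x : r m (r n x) = r (m + n) x.
Proof. symmetry; apply fpow_add; intros; [apply mulrVK | apply mulrKV]. Qed.

Lemma r_inj n x y : r n x = r n y -> x = y.
Proof.
intros H. apply (f_equal (r (- n))) in H. revert H. rewrite !r_add.
now replace (- n + n) with 0 by lia.
Qed.

Lemma r_l m n x : r m (l n x) = l n (r m x).
Proof.
apply (fpow_map _ _ (r m)); auto using mulKV, mulVK.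
intros y. symmetry.
apply (fpow_map _ _ (mul a)); auto using mulrVK, mulrKV.
intros z. apply flexible.
Qed.

Lemma fp_lr n x : fp n x = l n (r (- n) x).
Proof.
symmetry. pattern n. revert n. apply Z_bi_ind; [reflexivity|].
intros n. rewrite (fpow_succ _ f finv Tinv_K).
rewrite TmapE. change (a ** fp n x) with (l 1 (fp n x)).
change (l 1 (fp n x) ** inv a) with (r (-1) (l 1 (fp n x))).
split.
- intros <-. rewrite l_add, r_l, r_add. f_equal; [lia|f_equal; lia].
- intros E. apply (f_equal (l (-1))) in E. apply (f_equal (r 1)) in E.
  revert E. rewrite !r_l, !l_add, !r_add.
  replace (-1 + (n + 1)) with n by lia. replace (1 + - (n + 1)) with (- n) by lia.
  exact (fun E => E).
Qed.

Lemma middle_autotopism_pow n x y : l n x ** r n y = l n (r n (x ** y)).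
Proof.
rewrite <- fpow_comp; auto using mulKV, mulVK, mulrKV, mulrVK, flexible.
apply fpow_map2; auto using mulKV, mulVK, mulrKV, mulrVK, flexible.
- intros; now rewrite mulVK, mulrVK.
- intros; now rewrite mulrKV, mulKV.
- intros; rewrite flexible; apply moufang.
Qed.

Lemma left_autotopism_pow n x y : l n (r n x) ** l (- n) y = l n (x ** y).
Proof.
rewrite <- (fpow_comp Q (mul a) _ (fun x => x ** a));
  auto using mulKV, mulVK, mulrKV, mulrVK, flexible.
(* The middle component becomes an [n]-th power of [L^-1], so that all three components carry the
   same exponent. *)
replace (l (- n) y) with (fpow (mul (inv a)) (mul a) n y).
- apply fpow_map2; auto using mulKV, mulVK, mulrKV, mulrVK, flexible.
  + intros; now rewrite mulrKV, mulKV.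
  + intros; apply left_autotopism.
- pattern n. revert n. apply Z_bi_ind; [reflexivity|].
  intros n. rewrite fpow_succ by apply mulVK.
  replace (l (- n) y) with (a ** l (- (n + 1)) y).
  + split; intros E; [now rewrite E, mulVK | now rewrite <- E, mulKV].
  + change (l 1 (l (- (n + 1)) y) = l (- n) y). rewrite l_add. f_equal; lia.
Qed.

(** [a^n] unfolds to [L^n e]. Writing [x = R^n (R^-n x)] lets the middle autotopism act on [e] and
    [R^-n x]. *)
Lemma zpow_mul n x : zpow mul ldiv e a n ** x = l n x.
Proof.
change (l n e ** x = l n x).
replace x with (r n (r (- n) x)) at 1
  by (rewrite r_add; now replace (n + - n) with 0 by lia).
rewrite middle_autotopism_pow, mul1, r_add. now replace (n + - n) with 0 by lia.
Qed.

Lemma fp_e n : fp n e = e.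
Proof.
pattern n. revert n. apply Z_bi_ind; [reflexivity|].
assert (He : f e = e) by (rewrite TmapE, mulr1; apply mul_inv).
intros n. rewrite (fpow_succ _ f finv Tinv_K). split; intros E; [now rewrite E|].
now rewrite <- (Tmap_K (fp n e)), E, <- He, Tmap_K.
Qed.

Lemma mul_zpow n x : x ** zpow mul ldiv e a n = r n x.
Proof.
change (x ** l n e = r n x).
replace (l n e) with (r n e).
- replace x with (l n (l (- n) x)) at 1
    by (rewrite l_add; now replace (n + - n) with 0 by lia).
  rewrite middle_autotopism_pow, mulr1, <- r_l, l_add.
  now replace (n + - n) with 0 by lia.
- rewrite <- (fp_e n) at 1. rewrite fp_lr, r_l, r_add.
  now replace (n + - n) with 0 by lia.
Qed.

(* The two autotopisms shift the powers of [a] on the two factors by [(1, 1)]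
   and [(2, -1)]; as [(3 * i, 3 * j)] lies in the lattice they span, the product
   reduces to one of two elements conjugated by a power of [a]. *)
Lemma mul_shifted i j x y :
  l (3 * i) x ** r (3 * j) y =
  l (3 * (i + j)) (fp (- (i + 2 * j)) (fp (i - j) x ** fp (i - j) y)).
Proof.
(* With [m = i - j] for the left autotopism and [n = i + 2 * j] for the middle one,
   [3 * i = 2 * m + n] and [3 * j = n - m]; the powers of [f] absorb the remaining
   multiplications. *)
replace (l (3 * i) x) with (l (i - j) (r (i - j) (l (i + 2 * j) (fp (i - j) x)))).
2:{ rewrite fp_lr, !r_l, !l_add, !r_add. f_equal; [lia|].
    now replace (i - j + - (i - j)) with 0 by lia. }
replace (r (3 * j) y) with (l (- (i - j)) (r (i + 2 * j) (fp (i - j) y))).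
2:{ rewrite fp_lr, !r_l, !l_add, !r_add. replace (- (i - j) + (i - j)) with 0 by lia.
    change (r (i + 2 * j + - (i - j)) y = r (3 * j) y). f_equal; lia. }
rewrite left_autotopism_pow, middle_autotopism_pow, (fp_lr (- _)), !l_add.
f_equal; [lia | f_equal; lia].
Qed.

Lemma mul_cube_r x y : x ** r 3 y = r 3 (f (finv x ** finv y)).
Proof.
transitivity (l 3 (fp (-2) (fp (-1) x ** fp (-1) y)));
  [exact (mul_shifted 0 1 x y)|].
change (f (finv x ** finv y)) with (fp 1 (fp (-1) x ** fp (-1) y)).
rewrite (fp_lr (-2)), (fp_lr 1), r_l, l_add, r_add. reflexivity.
Qed.

Lemma cube_mul_r x y : r 3 x ** y = r 3 (f (f (finv (finv x) ** f y))).
Proof.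
replace (r 3 x) with (l (3 * 1) (fp (-3) x))
  by (rewrite fp_lr, l_add; reflexivity).
transitivity (l 3 (fp (-1) (fp 1 (fp (-3) x) ** fp 1 y)));
  [exact (mul_shifted 1 0 (fp (-3) x) y)|].
rewrite <- fpow_add by (apply Tmap_K || apply Tinv_K).
change (f (f (finv (finv x) ** f y))) with (fp 2 (fp (-2) x ** fp 1 y)).
rewrite (fp_lr (-1)), (fp_lr 2), r_l, l_add, r_add. reflexivity.
Qed.

(** Left Moufang law for [f x], [f y] and [a^3]: by [mul_cube_r], moving [a^3] out of the nested
    side collects a single [f] around [x(yx)]. *)
Lemma Tmap_semi x y : f (x ** (y ** x)) = f x ** (f y ** f x).
Proof.
generalize (left_moufang (f x) (f y) (r 3 e)).
rewrite !mul_cube_r. change (finv e) with (fp (-1) e).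
rewrite fp_e, mulr1, !Tinv_K, !Tmap_K, !mulr1, Tinv_K.
apply r_inj.
Qed.

(* The left Moufang law for [a u a^-1], [T_a^2(y) a^3] and [z], read on the coset of [a^3]. *)
Lemma Tmap_left_moufang u y z :
  u ** f (y ** f (f u ** z)) = f (finv (u ** f (y ** f (f u))) ** f z).
Proof.
generalize (left_moufang (f u) (r 3 (f (f y))) z).
rewrite !cube_mul_r, !mul_cube_r, cube_mul_r, !Tmap_K.
intros H. apply r_inj in H. now rewrite <- (Tmap_K (u ** _)), H, Tmap_K.
Qed.

End Powers.

Lemma Tmap_inv a x : Tmap mul rdiv (inv a) x = Tinv mul ldiv a x.
Proof.
rewrite TmapE, invK. unfold Tinv. apply (mulL_inj a). rewrite mulVL, flexible.
now rewrite mulKV.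
Qed.

Lemma Tinv_inv a x : Tinv mul ldiv (inv a) x = Tmap mul rdiv a x.
Proof. now rewrite <- Tmap_inv, invK. Qed.

End Moufang.

(** * The index intervals *)

Lemma Iset_succ i j :
  Iset i (j + 1) = (Iset i j ++ j :: nil)%list \/ Iset i j = j :: Iset i (j + 1).
Proof.
destruct (Z.leb_spec i j) as [H|H].
- left. unfold Iset. destruct (Z.ltb_spec i (j + 1)); [|lia].
  replace (Z.to_nat (j + 1 - i)) with (S (Z.to_nat (j - i))) by lia.
  rewrite seq_S, map_app. simpl. rewrite Z2Nat.id by lia.
  replace (i + (j - i)) with j by lia. f_equal.
  destruct (Z.ltb_spec i j); [reflexivity|].
  replace (Z.to_nat (j - i)) with O by lia.
  destruct (Z.ltb_spec j i); [lia|reflexivity].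
- right. unfold Iset. destruct (Z.ltb_spec i j); [lia|].
  destruct (Z.ltb_spec j i); [|lia].
  replace (Z.to_nat (i - j)) with (S (Z.to_nat (i - (j + 1)))) by lia.
  simpl. rewrite Z.add_0_r. f_equal.
  rewrite <- seq_shift, map_map.
  destruct (Z.ltb_spec i (j + 1)); [lia|].
  destruct (Z.ltb_spec (j + 1) i).
  + apply map_ext. intros k. lia.
  + now replace (Z.to_nat (i - (j + 1))) with O by lia.
Qed.

Lemma Iset_sym i j : Iset i j = Iset j i.
Proof.
unfold Iset. destruct (Z.ltb_spec i j), (Z.ltb_spec j i); reflexivity || lia.
Qed.

Lemma Iset_shift m i j : Iset (i + m) (j + m) = map (fun k => k + m) (Iset i j).
Proof.
unfold Iset. replace (j + m - (i + m)) with (j - i) by lia.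
replace (i + m - (j + m)) with (i - j) by lia.
destruct (Z.ltb_spec i j), (Z.ltb_spec (i + m) (j + m)); try lia.
- rewrite map_map. apply map_ext. intros k; lia.
- destruct (Z.ltb_spec j i), (Z.ltb_spec (j + m) (i + m)); try lia; [|reflexivity].
  rewrite map_map. apply map_ext. intros k; lia.
Qed.

(** * The action of an abelian group by the defects of a permutation *)

Section ActionOfDefects.
Variables (T : Type) (add : T -> T -> T) (opp : T -> T) (zero : T).
Local Notation "x ++ y" := (add x y).
Hypothesis addA : forall x y z, (x ++ y) ++ z = x ++ (y ++ z).
Hypothesis addC : forall x y, x ++ y = y ++ x.
Hypothesis add0 : forall x, zero ++ x = x.
Hypothesis addN : forall x, opp x ++ x = zero.

Lemma addKN x y : opp x ++ (x ++ y) = y.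
Proof. now rewrite <- addA, addN, add0. Qed.

Lemma addNK x y : x ++ (opp x ++ y) = y.
Proof. now rewrite <- addA, (addC x), addN, add0. Qed.

Lemma addI x y z : x ++ y = x ++ z -> y = z.
Proof. intros H. now rewrite <- (addKN x y), H, addKN. Qed.

Lemma addr0 x : x ++ zero = x.
Proof. now rewrite addC. Qed.

Lemma addCA x y z : x ++ (y ++ z) = y ++ (x ++ z).
Proof. now rewrite <- addA, (addC x), addA. Qed.

(* With [x +' y := f (finv x + finv y)], this is the permutation
   [z |-> (u +' z) - u]. *)
Definition defect (f finv : T -> T) u z := opp u ++ f (finv u ++ finv z).

Lemma add_defect f finv u z : u ++ defect f finv u z = f (finv u ++ finv z).
Proof. apply addNK. Qed.

Section Action.
Variables f finv : T -> T.
Hypothesis fK : forall x, finv (f x) = x.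
Hypothesis finvK : forall x, f (finv x) = x.
Hypothesis f0 : f zero = zero.
Hypothesis f_moufang : forall u y z,
  u ++ f (y ++ f (f u ++ z)) = f (finv (u ++ f (y ++ f (f u))) ++ f z).

(** In [f_moufang] take [y = -f (f u)] and [finv (finv z)] for [z]: the argument [y + f (f u)]
    vanishes and the right side becomes [f (finv u + finv z)]. *)
Lemma defectE u z :
  defect f finv u z = f (opp (f (f u)) ++ f (f u ++ finv (finv z))).
Proof.
symmetry. apply (addI u).
now rewrite add_defect, f_moufang, addN, f0, addr0, finvK.
Qed.

(** By [defectE], applying [finv] to the inner defect leaves an expression to which [f_moufang]
    applies again, now with [y = finv w - f (f u)]. *)
Lemma defect_act w u z :
  defect f finv w (defect f finv u z) = defect f finv (u ++ w) z.
Proof.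
apply (addI (u ++ w)). rewrite add_defect, addA, add_defect, defectE, fK.
rewrite <- addA, f_moufang, !finvK, addA, addN, addr0, finvK. reflexivity.
Qed.

Lemma defect_inj u z z' : defect f finv u z = defect f finv u z' -> z = z'.
Proof.
intros H. apply addI in H. apply (f_equal finv) in H. rewrite !fK in H.
apply addI in H. now rewrite <- (finvK z), H, finvK.
Qed.

End Action.
End ActionOfDefects.

(** * Moufang permutations *)

Section MoufangPermutation.
Variables (T : Type) (add : T -> T -> T) (opp : T -> T) (zero : T).
Variables (f finv : T -> T).
Local Notation "x ++ y" := (add x y).
Hypothesis addA : forall x y z, (x ++ y) ++ z = x ++ (y ++ z).
Hypothesis addC : forall x y, x ++ y = y ++ x.
Hypothesis add0 : forall x, zero ++ x = x.
Hypothesis addN : forall x, opp x ++ x = zero.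
Hypothesis fK : forall x, finv (f x) = x.
Hypothesis finvK : forall x, f (finv x) = x.
Hypothesis f0 : f zero = zero.
Hypothesis f_semi : forall x y, f (x ++ (y ++ x)) = f x ++ (f y ++ f x).
Hypothesis f_moufang : forall u y z,
  u ++ f (y ++ f (f u ++ z)) = f (finv (u ++ f (y ++ f (f u))) ++ f z).
Hypothesis finv_moufang : forall u y z,
  u ++ finv (y ++ finv (finv u ++ z)) =
  finv (f (u ++ finv (y ++ finv (finv u))) ++ finv z).

Local Notation b := (beta add opp f finv).
Local Notation addI := (addI T add opp zero addA add0 addN).
Local Notation addKN := (addKN T add opp zero addA add0 addN).
Local Notation addNK := (addNK T add opp zero addA addC add0 addN).
Local Notation addr0 := (addr0 T add zero addC add0).
Local Notation addCA := (addCA T add addA addC).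
Local Notation P := (defect T add opp finv f).
Local Notation N := (defect T add opp f finv).
Local Notation add_defect := (add_defect T add opp zero addA addC add0 addN).

Lemma finv0 : finv zero = zero.
Proof. now rewrite <- f0 at 1. Qed.

Lemma betaE x y : finv (f x ++ f y) = x ++ (y ++ b x y).
Proof.
unfold beta. rewrite (addC _ (opp y)), addNK, (addC _ (opp x)), addNK.
reflexivity.
Qed.

Lemma f_add_beta x y : f (x ++ (y ++ b x y)) = f x ++ f y.
Proof. now rewrite <- betaE, finvK. Qed.

(** Links the action to [b]: the action law for [P] will become additivity of [b] in its first
    argument. *)
Lemma PE x z : P x z = z ++ b x z.
Proof. apply (addI x). now rewrite add_defect, betaE. Qed.

Lemma P_act w u z : P w (P u z) = P (u ++ w) z.
Proof. apply (defect_act T add opp zero); auto using finv0. Qed.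

Lemma P_inj u z z' : P u z = P u z' -> z = z'.
Proof. apply (defect_inj T add opp zero); auto. Qed.

Lemma N_f_P x z : N (f x) (f (P x z)) = f z.
Proof. apply (addI (f x)). now rewrite !add_defect, !fK, add_defect, finvK. Qed.

Lemma beta_sym x y : b x y = b y x.
Proof.
apply (addI y), (addI x). rewrite <- betaE, addCA, <- betaE. now rewrite addC.
Qed.

(* Conjugating by [f] turns the action for [f] into the inverse of the action
   for [finv]; so the latter is a morphism both for [add] and for the sum
   transported along [f], which forces their difference [b x w] to act trivially. *)
Lemma beta_beta x w z : b (b x w) z = zero.
Proof.
assert (H : forall z, P (x ++ w ++ b x w) z = P (x ++ w) z).
{ clear z; intros z. rewrite <- betaE.
  (* [P zero] only gives both sides a shape in which [fK] can expose an [f]; the action law then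
     absorbs it. *)
  apply (P_inj zero). rewrite <- (fK (P zero _)), <- (fK (P zero (P (_ ++ _) _))).
  f_equal. rewrite !P_act, !addr0.
  (* Both sides are sent to [f z] by [N (f x + f w)]: the first in one step, the second in two after
     splitting both actions. *)
  apply (defect_inj T add opp zero) with (f := f) (finv := finv) (u := f x ++ f w); auto.
  transitivity (f z).
  - rewrite <- (finvK (f x ++ f w)) at 1. apply N_f_P.
  - rewrite <- (defect_act T add opp zero) by auto.
    rewrite addC, <- P_act, !N_f_P. reflexivity. }
apply (addI z). rewrite <- PE, addr0. apply (P_inj (x ++ w)).
now rewrite P_act, (addC (b x w)), addA, H.
Qed.

Definition radical r := forall z, b r z = zero.

(** A radical [r] acts trivially through [P], so [P (z + r) = P z] by the action law. *)
Lemma beta_radical r z x : radical r -> b x (z ++ r) = b x z.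
Proof.
intros Hr. rewrite !(beta_sym x). apply (addI x).
now rewrite <- !PE, addC, <- P_act, (PE r), Hr, addr0.
Qed.

(** Expand [P (x + y) z = P y (P x z)]. The [b x z] inside the argument of [b y] is radical by
    [beta_beta] and drops out. *)
Lemma betaDl x y z : b (x ++ y) z = b x z ++ b y z.
Proof.
apply (addI z). rewrite <- PE, <- P_act, PE, PE, addA.
rewrite beta_radical; [reflexivity|]. intros u. apply beta_beta.
Qed.

Lemma betaDr x y z : b z (x ++ y) = b z x ++ b z y.
Proof. rewrite !(beta_sym z). apply betaDl. Qed.

Lemma f_double x : f (x ++ x) = f x ++ f x.
Proof. generalize (f_semi x zero). now rewrite f0, !add0. Qed.

Lemma beta_alt x : b x x = zero.
Proof. apply (addI (x ++ x)). now rewrite addA, <- betaE, <- f_double, fK, addr0. Qed.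

(** By [f_semi] and [f_double], [f (x + y + x) = f (x + x) + f y], so [b (x + x) y] vanishes. *)
Lemma beta_double x y : b x y ++ b x y = zero.
Proof.
rewrite <- betaDl. apply (addI y), (addI (x ++ x)).
rewrite <- betaE, f_double, addA, (addC (f x) (f y)), <- f_semi, fK, addr0.
now rewrite (addC y x), addA.
Qed.

Lemma f_add_radical r x : radical r -> f (x ++ r) = f x ++ f r.
Proof.
intros Hr. rewrite <- f_add_beta. now rewrite beta_sym, Hr, addr0.
Qed.

(** [defectE] for [finv] at [u = f^3 x]: there [finv u] and [finv (finv u)] are [f (f x)] and [f x],
    so the inner sum is the one defining [b (f x) (f y)]. Applying [f] to the left side splits it,
    as values of [b] are radical. *)
Lemma beta_f x y : b (f x) (f y) = f (b (f (f (f x))) y).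
Proof.
assert (H := defectE T add opp zero addA addC add0 addN finv f fK finv0
  finv_moufang (f (f (f x))) y).
rewrite PE, !fK in H. apply (f_equal f) in H. rewrite finvK in H.
rewrite f_add_radical in H by (intros z; apply beta_beta).
apply (addI (f y)). rewrite H. apply (addI (f x)).
now rewrite addNK, betaE.
Qed.

Lemma beta_f3_swap x y : b (f (f (f x))) y = b x (f (f (f y))).
Proof.
rewrite (beta_sym x), <- (fK (b _ y)), <- (fK (b _ x)), <- !beta_f.
now rewrite beta_sym.
Qed.

(** Swapping gives [b (f^6 x) y = b (f^3 x) (f^3 y)]. Extracting three [f] by [beta_f], each at the
    cost of [f^3] on the first argument, gives [f^3 (b (f^9 x) y)]; then replace [x] by [f^-6 x]. *)
Lemma beta_f3 x y : f (f (f (b (f (f (f x))) y))) = b x y.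
Proof.
assert (H : forall x, f (f (f (b (f (f (f (f (f (f (f (f (f x))))))))) y))) =
                      b (f (f (f (f (f (f x)))))) y).
{ clear x; intros x. now rewrite (beta_f3_swap (f (f (f x))) y), !beta_f. }
generalize (H (finv (finv (finv (finv (finv (finv x))))))). now rewrite !finvK.
Qed.

(** * Iterates of [f] and the sums over intervals *)

Local Notation fp := (fpow f finv).

Lemma fp_add m n x : fp m (fp n x) = fp (m + n) x.
Proof. symmetry. now apply fpow_add. Qed.

Lemma fp_zero n : fp n zero = zero.
Proof.
pattern n. revert n. apply Z_bi_ind; [reflexivity|].
intros n. rewrite fpow_succ by assumption. split; intros E; [now rewrite E|].
now rewrite <- (fK (fp n zero)), E, finv0.
Qed.

Lemma fp_radical n r : radical r -> radical (fp n r).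
Proof.
pattern n. revert n. apply Z_bi_ind; [auto|].
assert (Hf : forall s, radical s <-> radical (f s)).
{ intros s; split; intros Hs z.
  - rewrite <- (finvK z), beta_sym, beta_f, beta_sym, Hs. apply f0.
  - rewrite <- (beta_f3 s z), <- beta_f, Hs.
    now rewrite !f0. }
intros n. rewrite fpow_succ by assumption. rewrite <- Hf. reflexivity.
Qed.

Lemma fp_add_radical n x r : radical r -> fp n (x ++ r) = fp n x ++ fp n r.
Proof.
intros Hr. pattern n. revert n. apply Z_bi_ind; [reflexivity|].
intros n. rewrite !fpow_succ, <- f_add_radical by auto using fp_radical.
split; intros E; [now rewrite E|]. now rewrite <- (fK (fp n (x ++ r))), E, fK.
Qed.

(** Each [f] on both arguments contributes [f^-2], since [f (b (f^3 u) v)] is [f^-2] of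
    [f^3 (b (f^3 u) v) = b u v]. *)
Lemma beta_fp n x y : b (fp n x) (fp n y) = fp (- 2 * n) (b x y).
Proof.
assert (Hf : forall u v, b (f u) (f v) = fp (-2) (b u v)).
{ intros u v. rewrite beta_f, <- (beta_f3 u v).
  change (f (b (f (f (f u))) v) = fp (-2) (fp 3 (b (f (f (f u))) v))).
  now rewrite fp_add. }
pattern n. revert n. apply Z_bi_ind; [reflexivity|].
intros n. rewrite !fpow_succ, Hf by assumption.
replace (- 2 * (n + 1)) with (- 2 + - 2 * n) by lia. rewrite <- fp_add.
split; intros E; [now rewrite E|].
apply (f_equal (fp 2)) in E. revert E. now rewrite !fp_add.
Qed.

Local Notation S := (zsum add zero).

Lemma zsum_app G s t : S G (s ++ t)%list = S G s ++ S G t.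
Proof.
induction s as [|k s IH]; simpl; [now rewrite add0|]. now rewrite IH, addA.
Qed.

(** Moving the end past [j] gains the index [j] or loses it; for terms of order two both amount to
    adding [G j]. *)
Lemma zsum_Iset_succ G i j : (forall k, G k ++ G k = zero) ->
  S G (Iset i (j + 1)) = S G (Iset i j) ++ G j.
Proof.
intros HG. destruct (Iset_succ i j) as [->| ->].
- rewrite zsum_app. simpl. now rewrite addr0.
- simpl. rewrite (addC (G j)), addA, HG, addr0. reflexivity.
Qed.

(** The step from [n] to [n + 1] contributes [f^-n (b (f^n x) (f^n y))], which is [f^(-3n) (b x y)]
    by [beta_fp]; it splits off because it is radical. *)
Lemma fpow_add_defect n x y :
  fp (- n) (fp n x ++ fp n y) =
  (x ++ y) ++ S (fun k => fp (- 3 * k) (b x y)) (Iset 0 n).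
Proof.
pattern n. revert n. apply Z_bi_ind; [simpl; now rewrite addr0|].
intros n. rewrite zsum_Iset_succ.
2:{ intros k. rewrite <- fp_add_radical, beta_double by (intros z; apply beta_beta).
    apply fp_zero. }
assert (H : fp (- (n + 1)) (fp (n + 1) x ++ fp (n + 1) y) =
            fp (- n) (fp n x ++ fp n y) ++ fp (- 3 * n) (b x y)).
{ replace (- (n + 1)) with (- n + -1) by lia. rewrite !fpow_succ by assumption.
  rewrite <- fp_add. change (fp (-1)) with finv. rewrite betaE, <- addA.
  rewrite fp_add_radical by (intros z; apply beta_beta).
  rewrite beta_fp, fp_add. now replace (- n + - 2 * n) with (- 3 * n) by lia. }
rewrite H, <- addA. split; intros E; [now rewrite E|].
revert E. rewrite !(addC _ (fp (- 3 * n) (b x y))). apply addI.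
Qed.

Lemma zsum_ext G G' s : (forall k, G k = G' k) -> S G s = S G' s.
Proof.
intros H. induction s as [|k s IH]; simpl; [reflexivity|]. now rewrite H, IH.
Qed.

Lemma zsum_shift G m i j :
  S (fun k => G (k + m)) (Iset i j) = S G (Iset (i + m) (j + m)).
Proof.
rewrite Iset_shift. generalize (Iset i j) as s.
induction s as [|k s IH]; simpl; [reflexivity|]. now rewrite IH.
Qed.

(** Use [fpow_add_defect] with [n = i + 2 * j] at [f^(-3j) x] and [f^(-3j) y]. Their [b] is
    [f^(6j) (b x y)], which shifts the interval by [-2 * j]. *)
Lemma fpow_product_left i j x y :
  fp (- (i + 2 * j)) (fp (i - j) x ++ fp (i - j) y) =
  (fp (- 3 * j) x ++ fp (- 3 * j) y) ++
  S (fun k => fp (- 3 * k) (b x y)) (Iset (- 2 * j) i).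
Proof.
replace (i - j) with (i + 2 * j + - 3 * j) by lia.
rewrite <- !(fp_add (i + 2 * j) (- 3 * j)), fpow_add_defect, beta_fp. f_equal.
replace (Iset (- 2 * j) i) with (Iset (0 + - 2 * j) (i + 2 * j + - 2 * j))
  by (f_equal; lia).
rewrite <- zsum_shift. apply zsum_ext. intros k. rewrite fp_add. f_equal. lia.
Qed.

(** [b x (f^3 v) = b (f^3 x) v] by the swap, and this is [f^-3 (b x v)] by [beta_f3]. *)
Lemma beta_fp_r j x y : b x (fp (3 * j) y) = fp (- 3 * j) (b x y).
Proof.
assert (H3 : forall v, b x (fp 3 v) = fp (-3) (b x v)).
{ intros v. rewrite <- (beta_f3 x v).
  change (b x (f (f (f v))) = fp (-3) (fp 3 (b (f (f (f x))) v))).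
  now rewrite fp_add, beta_f3_swap. }
pattern j. revert j. apply Z_bi_ind; [reflexivity|].
intros j. replace (3 * (j + 1)) with (3 + 3 * j) by lia.
replace (- 3 * (j + 1)) with (-3 + - 3 * j) by lia.
rewrite <- !fp_add, H3. split; intros E; [now rewrite E|].
apply (f_equal (fp 3)) in E. revert E. now rewrite !fp_add.
Qed.

(** The left formula at [f^(3j) y]; the extra [f^(-3j)] on [b x y] shifts the interval by [j]. *)
Lemma fpow_product_right i j x y :
  fp (- (i + 2 * j)) (fp (i - j) x ++ fp (i - j) (fp (3 * j) y)) =
  (fp (- 3 * j) x ++ y) ++
  S (fun k => fp (- 3 * k) (b x y)) (Iset (i + j) (- j)).
Proof.
rewrite fpow_product_left, fp_add, beta_fp_r.
replace (- 3 * j + 3 * j) with 0 by lia. change (fp 0 y) with y. f_equal.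
rewrite (Iset_sym (i + j)).
replace (Iset (- j) (i + j)) with (Iset (- 2 * j + j) (i + j)) by (f_equal; lia).
rewrite <- zsum_shift. apply zsum_ext. intros k. rewrite fp_add. f_equal. lia.
Qed.

Lemma moufang_perm : moufang_perm_on add opp zero f finv (fun _ => True).
Proof.
repeat split; auto using beta_sym, beta_alt, betaDl, betaDr, beta_beta, beta_f.
Qed.

End MoufangPermutation.

(** * Transfer to the subgroup [X] of the loop *)

Lemma sig_inj (A : Type) (X : A -> Prop) (u v : sig X) :
  proj1_sig u = proj1_sig v -> u = v.
Proof.
destruct u as [u Hu], v as [v Hv]; simpl. intros ->. f_equal. apply proof_irrelevance.
Qed.

Lemma zsum_map (T U : Type) (h : T -> U) addT zT addU zU G s :
  h zT = zU -> (forall x y, h (addT x y) = addU (h x) (h y)) ->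
  h (zsum addT zT G s) = zsum addU zU (fun k => h (G k)) s.
Proof.
intros Hz Ha. induction s as [|k s IH]; simpl; [exact Hz|]. now rewrite Ha, IH.
Qed.

Theorem mainTheorem15 (Q : Type) (mul ldiv rdiv : Q -> Q -> Q) (e : Q)
  (HQ : is_moufang_loop mul ldiv rdiv e)
  (X : Q -> Prop) (HX : abelian_normal_subgroup mul ldiv rdiv e X)
  (a : Q) :
  let f := Tmap mul rdiv a in
  let finv := Tinv mul ldiv a in
  let add := mul in
  let opp := linv ldiv e in
  let pw := zpow mul ldiv e a in
  moufang_perm_on add opp e f finv X /\
  (forall (i j : Z) (x y : Q), X x -> X y ->
     mul (mul (pw (3 * i)) x) (mul y (pw (3 * j))) =
     mul (pw (3 * (i + j)))
       (add (add (fpow f finv (- 3 * j) x) (fpow f finv (- 3 * j) y))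
            (zsum add e (fun k => fpow f finv (- 3 * k) (beta add opp f finv x y))
                  (Iset (- 2 * j) i)))) /\
  (forall (i j : Z) (x y : Q), X x -> X y ->
     mul (mul (pw (3 * i)) x) (mul (pw (3 * j)) y) =
     mul (pw (3 * (i + j)))
       (add (add (fpow f finv (- 3 * j) x) y)
            (zsum add e (fun k => fpow f finv (- 3 * k) (beta add opp f finv x y))
                  (Iset (i + j) (- j))))).
Proof.
intros f finv add opp pw.
destruct HX as [[Xe [Xmul [Xldiv _]]] [[XA XC] Xnormal]].
destruct (Xnormal a a) as [[Xf Xonto] _].
assert (fK : forall x, finv (f x) = x) by apply (Tmap_K _ _ _ _ _ HQ).
assert (finvK : forall x, f (finv x) = x) by apply (Tinv_K _ _ _ _ _ HQ).
(* Normality makes [T_a] map [X] onto itself, hence [X] is closed under [finv]. *)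
assert (Xfinv : forall x, X x -> X (finv x)).
{ intros x Hx. destruct (Xonto x Hx) as [w [Hw <-]].
  replace (finv _) with w by (symmetry; apply fK). exact Hw. }
assert (Xopp : forall x, X x -> X (opp x)) by (intros x Hx; now apply Xldiv).
(* The group laws hold only on [X], so the abstract results are applied to the subset type; proof
   irrelevance reduces its equations to equations in [Q]. *)
pose (T := sig X).
pose (addT := fun u v : T =>
  exist X (add (proj1_sig u) (proj1_sig v)) (Xmul _ _ (proj2_sig u) (proj2_sig v))).
pose (oppT := fun u : T => exist X (opp (proj1_sig u)) (Xopp _ (proj2_sig u))).
pose (fT := fun u : T => exist X (f (proj1_sig u)) (Xf _ (proj2_sig u))).
pose (gT := fun u : T => exist X (finv (proj1_sig u)) (Xfinv _ (proj2_sig u))).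
pose (eT := exist X e Xe : T).
assert (addTA : forall x y z, addT (addT x y) z = addT x (addT y z)).
{ intros [x Hx] [y Hy] [z Hz]. now apply sig_inj, XA. }
assert (addTC : forall x y, addT x y = addT y x).
{ intros [x Hx] [y Hy]. now apply sig_inj, XC. }
assert (addT0 : forall x, addT eT x = x).
{ intros x. apply sig_inj, (mul1 _ _ _ _ _ HQ). }
assert (addTN : forall x, addT (oppT x) x = eT).
{ intros x. apply sig_inj, (inv_mul _ _ _ _ _ HQ). }
assert (fTK : forall x, gT (fT x) = x) by (intros x; apply sig_inj, fK).
assert (gTK : forall x, fT (gT x) = x) by (intros x; apply sig_inj, finvK).
assert (fT0 : fT eT = eT) by (apply sig_inj, (fp_e _ _ _ _ _ HQ a 1)).
assert (fT_semi : forall x y,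
  fT (addT x (addT y x)) = addT (fT x) (addT (fT y) (fT x))).
{ intros x y. apply sig_inj, (Tmap_semi _ _ _ _ _ HQ). }
assert (fT_moufang : forall u y z,
  addT u (fT (addT y (fT (addT (fT u) z)))) =
  fT (addT (gT (addT u (fT (addT y (fT (fT u)))))) (fT z))).
{ intros u y z. apply sig_inj, (Tmap_left_moufang _ _ _ _ _ HQ). }
assert (gT_moufang : forall u y z,
  addT u (gT (addT y (gT (addT (gT u) z)))) =
  gT (addT (fT (addT u (gT (addT y (gT (gT u)))))) (gT z))).
{ intros u y z. apply sig_inj. simpl.
  (* Passing from [a] to [a^-1] exchanges [f] and [finv]. *)
  generalize (Tmap_left_moufang _ _ _ _ _ HQ (opp a)
    (proj1_sig u) (proj1_sig y) (proj1_sig z)).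
  unfold opp. now rewrite !(Tmap_inv _ _ _ _ _ HQ), (Tinv_inv _ _ _ _ _ HQ). }
pose (val := @proj1_sig Q X).
assert (val_fpow : forall n u, val (fpow fT gT n u) = fpow f finv n (val u)).
{ intros n u. now apply fpow_map. }
assert (val_sum : forall u v s,
  val (zsum addT eT (fun k => fpow fT gT (- 3 * k) (beta addT oppT fT gT u v)) s) =
  zsum add e
    (fun k => fpow f finv (- 3 * k) (beta add opp f finv (val u) (val v))) s).
{ intros u v s. rewrite (zsum_map _ _ val addT eT add e) by reflexivity.
  apply zsum_ext. intros k. now rewrite val_fpow. }
split; [|split].
- destruct (moufang_perm T addT oppT eT fT gT) as
    (_ & _ & _ & _ & Hsym & Halt & Hl & Hr & Hbb & Hf); auto.
  repeat split; auto.
  + intros x y Hx Hy. exact (f_equal val (Hsym (exist X x Hx) (exist X y Hy) I I)).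
  + intros x Hx. exact (f_equal val (Halt (exist X x Hx) I)).
  + intros x y z Hx Hy Hz.
    exact (f_equal val (Hl (exist X x Hx) (exist X y Hy) (exist X z Hz) I I I)).
  + intros x y z Hx Hy Hz.
    exact (f_equal val (Hr (exist X x Hx) (exist X y Hy) (exist X z Hz) I I I)).
  + intros x y z Hx Hy Hz.
    exact (f_equal val (Hbb (exist X x Hx) (exist X y Hy) (exist X z Hz) I I I)).
  + intros x y Hx Hy. exact (f_equal val (Hf (exist X x Hx) (exist X y Hy) I I)).
- intros i j x y Hx Hy. unfold pw.
  rewrite (mul_zpow _ _ _ _ _ HQ), !(zpow_mul _ _ _ _ _ HQ), (mul_shifted _ _ _ _ _ HQ).
  f_equal.
  pose proof (f_equal val (fpow_product_left T addT oppT eT fT gT addTA addTC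
    addT0 addTN fTK gTK fT0 fT_semi fT_moufang gT_moufang i j
    (exist X x Hx) (exist X y Hy))) as H.
  rewrite val_fpow in H. cbn [addT val proj1_sig] in H.
  fold val in H. rewrite !val_fpow, val_sum in H. exact H.
- intros i j x y Hx Hy. unfold pw.
  rewrite !(zpow_mul _ _ _ _ _ HQ).
  (* [a^(3j) y = f^(3j)(y) a^(3j)] brings the product to the form of the first formula. *)
  replace (fpow (mul a) (mul (linv ldiv e a)) (3 * j) y) with
    (fpow (fun x => mul x a) (fun x => mul x (linv ldiv e a)) (3 * j)
       (fpow f finv (3 * j) y)).
  2:{ unfold f, finv. rewrite (fp_lr _ _ _ _ _ HQ), (r_l _ _ _ _ _ HQ), (r_add _ _ _ _ _ HQ).
      now replace (3 * j + - (3 * j)) with 0 by lia. }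
  rewrite (mul_shifted _ _ _ _ _ HQ). f_equal.
  pose proof (f_equal val (fpow_product_right T addT oppT eT fT gT addTA addTC
    addT0 addTN fTK gTK fT0 fT_semi fT_moufang gT_moufang i j
    (exist X x Hx) (exist X y Hy))) as H.
  rewrite val_fpow in H. cbn [addT val proj1_sig] in H.
  fold val in H. rewrite !val_fpow, val_sum in H. exact H.
Qed.
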